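(* Let $A\in\mathcal{V}$ and $\theta\in Con(A)$. The following are equivalent: (1) $\theta$ has $CBLP$; (2) for all congruences $\phi,\psi$ of $A$ with $\phi\vee\psi=\nabla_A$ and $[\phi,\psi]\subseteq\theta$, there exists $\alpha\in B(Con(A))$ with $\alpha\subseteq\theta\vee\phi$ and $\neg\alpha\subseteq\theta\vee\psi$; (3) for all congruences $\phi,\psi$ of $A$ with $\phi\vee\psi=\nabla_A$ and $[\phi,\psi]=\theta$, there exists $\alpha\in B(Con(A))$ with $\alpha\subseteq\theta\vee\phi$ and $\neg\alpha\subseteq\theta\vee\psi$; (4) for every maximal congruence $\phi$ of $A$, $|B(Con(A/(\theta\vee\phi^{\diamond})))|\leq 2$.
   Context: $\mathcal{V}$ is a congruence modular, semidegenerate variety (no nontrivial algebra has a one-element subalgebra) of finite signature. For $B\in\mathcal{V}$: $Con(B)$ is its congruence lattice with bounds $\Delta_B,\nabla_B$, $[\cdot,\cdot]$ the Freese–McKenzie commutator, $K(B)$ the compact congruences. A congruence $\phi\neq\nabla_B$ is prime if $[\alpha,\beta]\subseteq\phi$ implies $\alpha\subseteq\phi$ or $\beta\subseteq\phi$; $\rho(\theta)$ is the intersection of primes containing $\theta$. $B(Con(B))$ is the Boolean algebra of complemented elements of $Con(B)$, with complement $\neg\alpha$. When $K(B)$ is closed under the commutator, the reticulation $L(B)=K(B)/{\equiv}$ ($\alpha\equiv\beta$ iff $\rho(\alpha)=\rho(\beta)$) is a bounded distributive lattice with canonical map $\lambda_B$, mapping $B(Con(B))$ injectively into $B(L(B))$;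 the reticulation preserves the Boolean center if this map is onto $B(L(B))$. Standing assumption: for every $B\in\mathcal{V}$, $K(B)$ is closed under the commutator and the reticulation of $B$ preserves the Boolean center. For $\phi\in Con(A)$, $\phi^{\diamond}=\bigvee\{\alpha\in B(Con(A)):\alpha\subseteq\phi\}$. A congruence $\theta$ of $A$ has $CBLP$ if for every $\beta\in B(Con(A/\theta))$ there is $\alpha\in B(Con(A))$ with $(\alpha\vee\theta)/\theta=\beta$. *)

(* Defs.v *)
From mathcomp Require Import all_boot.
From Stdlib Require Import ClassicalEpsilon.
From Stdlib Require List.

Set Implicit Arguments.
Unset Strict Implicit.
Unset Printing Implicit Defensive.

Record signature := Signature { sym : finType; ar : sym -> nat }.

Record algebra (S : signature) := Algebra {
  car :> Type;
  op : forall i : sym S, ('I_(ar i) -> car) -> car }.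

Inductive term (S : signature) : Type :=
  | Var : nat -> term S
  | App : forall i : sym S, ('I_(ar i) -> term S) -> term S.

Fixpoint eval (S : signature) (A : algebra S) (v : nat -> A) (t : term S) : A :=
  match t with
  | Var n => v n
  | App i f => @op S A i (fun k => eval v (f k))
  end.

(* A variety is given (Birkhoff) by a set of identities E; A is in V iff A |= E. *)
Definition models (S : signature) (E : term S -> term S -> Prop) (A : algebra S) :=
  forall s t, E s t -> forall v : nat -> A, eval v s = eval v t.

Definition prel (T : Type) := T -> T -> Prop.
Definition psubrel T (R R' : prel T) := forall x y, R x y -> R' x y.
Definition releq T (R R' : prel T) := forall x y, R x y <-> R' x y.

Definition is_con (S : signature) (A : algebra S) (R : prel A) : Prop :=
  (forall x, R x x) /\ (forall x y, R x y -> R y x) /\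
  (forall x y z, R x y -> R y z -> R x z) /\
  (forall i (f g : 'I_(ar i) -> A), (forall k, R (f k) (g k)) -> R (@op S A i f) (@op S A i g)).

Definition Delta (T : Type) : prel T := fun x y => x = y.
Definition Nabla (T : Type) : prel T := fun _ _ => True.
Definition meet T (R R' : prel T) : prel T := fun x y => R x y /\ R' x y.

Definition cg (S : signature) (A : algebra S) (U : prel A) : prel A :=
  fun x y => forall T, is_con T -> psubrel U T -> T x y.

Definition join (S : signature) (A : algebra S) (R R' : prel A) : prel A :=
  cg (fun x y => R x y \/ R' x y).

Definition is_compl (S : signature) (A : algebra S) (a b : prel A) : Prop :=
  is_con a /\ is_con b /\ releq (meet a b) (@Delta A) /\ releq (join a b) (@Nabla A).

Definition boolean (S : signature) (A : algebra S) (a : prel A) : Prop :=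
  exists b, is_compl a b.

Definition compact (S : signature) (A : algebra S) (a : prel A) : Prop :=
  is_con a /\
  forall (J : Type) (F : J -> prel A), (forall j, is_con (F j)) ->
    psubrel a (cg (fun x y => exists j, F j x y)) ->
    exists s : list J, psubrel a (cg (fun x y => exists j, List.In j s /\ F j x y)).

Definition mixv (T : Type) (m : nat) (a c : nat -> T) : nat -> T :=
  fun n => if n < m then a n else c n.

Definition centralizes (S : signature) (A : algebra S) (al be de : prel A) : Prop :=
  forall (t : term S) (m : nat) (a b c d : nat -> A),
    (forall n, al (a n) (b n)) -> (forall n, be (c n) (d n)) ->
    de (eval (mixv m a c) t) (eval (mixv m a d) t) ->
    de (eval (mixv m b c) t) (eval (mixv m b d) t).

Definition comm (S : signature) (A : algebra S) (al be : prel A) : prel A :=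
  fun x y => forall de, is_con de -> centralizes al be de -> de x y.

Definition prime_con (S : signature) (A : algebra S) (p : prel A) : Prop :=
  is_con p /\ ~ releq p (@Nabla A) /\
  forall a b, is_con a -> is_con b -> psubrel (comm a b) p -> psubrel a p \/ psubrel b p.

Definition rho (S : signature) (A : algebra S) (th : prel A) : prel A :=
  fun x y => forall p, prime_con p -> psubrel th p -> p x y.

Definition maximal_con (S : signature) (A : algebra S) (p : prel A) : Prop :=
  is_con p /\ ~ releq p (@Nabla A) /\
  forall q, is_con q -> psubrel p q -> releq q p \/ releq q (@Nabla A).

Definition diamond (S : signature) (A : algebra S) (phi : prel A) : prel A :=
  cg (fun x y => exists al, boolean al /\ psubrel al phi /\ al x y).

Definition qcar (S : signature) (A : algebra S) (th : prel A) : Type :=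
  { P : A -> Prop | exists a, P = th a }.

Definition cls (S : signature) (A : algebra S) (th : prel A) (a : A) : qcar th :=
  exist _ (th a) (ex_intro _ a erefl).

Definition rep (S : signature) (A : algebra S) (th : prel A) (X : qcar th) : A :=
  proj1_sig (constructive_indefinite_description _ (proj2_sig X)).

Definition quot (S : signature) (A : algebra S) (th : prel A) : algebra S :=
  @Algebra S (qcar th) (fun i f => cls th (@op S A i (fun k => rep (f k)))).

Definition qcon (S : signature) (A : algebra S) (th al : prel A) : prel (quot th) :=
  fun X Y => exists a b, X = cls th a /\ Y = cls th b /\ join al th a b.

Definition modular_con (S : signature) (A : algebra S) : Prop :=
  forall a b c : prel A, is_con a -> is_con b -> is_con c -> psubrel a c ->
    releq (join a (meet b c)) (meet (join a b) c).

Definition congruence_modular (S : signature) (E : term S -> term S -> Prop) :=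
  forall B : algebra S, models E B -> modular_con B.

Definition semidegenerate (S : signature) (E : term S -> term S -> Prop) :=
  forall B : algebra S, models E B -> (exists x y : B, x <> y) ->
    ~ exists x : B, forall i (f : 'I_(ar i) -> B), (forall k, f k = x) -> @op S B i f = x.

Definition K_comm_closed (S : signature) (B : algebra S) : Prop :=
  forall a b : prel B, compact a -> compact b -> compact (comm a b).

(* lambda_B : B(Con(B)) -> B(L(B)) is onto.  In L(B) = K(B)/==, the class of a
   compact a is complemented iff there is a compact b with
   [a] \/ [b] = [Nabla] and [a] /\ [b] = [[a,b]] = [Delta]. *)
Definition reticulation_preserves_bc (S : signature) (B : algebra S) : Prop :=
  forall a : prel B, compact a ->
    (exists b, compact b /\ releq (rho (join a b)) (rho (@Nabla B))
                         /\ releq (rho (comm a b)) (rho (@Delta B))) ->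
    exists al, boolean al /\ compact al /\ releq (rho al) (rho a).

Definition standing (S : signature) (E : term S -> term S -> Prop) :=
  congruence_modular E /\ semidegenerate E /\
  forall B : algebra S, models E B -> K_comm_closed B /\ reticulation_preserves_bc B.

Definition CBLP (S : signature) (A : algebra S) (th : prel A) : Prop :=
  forall be : prel (quot th), boolean be ->
    exists al : prel A, boolean al /\ releq (@qcon S A th al) be.

Definition at_most_two_boolean (S : signature) (B : algebra S) : Prop :=
  forall a b c : prel B, boolean a -> boolean b -> boolean c ->
    releq a b \/ releq a c \/ releq b c.

(* Main.v *)
(* Under the commutator, the congruences of A form an algebraic lattice with a commutative
   multiplication that distributes over binary joins, has the top congruence as unit, and
   preserves compactness; the theorem holds in any such lattice with compact top. If
   a \/ b = 1 then a /\ b = a * b, so the Boolean congruences of A/t correspond to the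
   pairs with a \/ b = 1 and a * b = t, and (2) and (3) ask for complemented elements that
   split such pairs.

   For (2) => (4), a complemented pair over t \/ m^diamond, with m maximal, is approximated
   by compact f0, g0; as f0 * g0 is compact, it lies in t \/ e for one complemented e <= m,
   and splitting off e leads back to (2). For (4) => (2), no maximal m contains all
   complemented elements below t \/ a and below t \/ b, because one of these two congruences
   joins with m^diamond to 1; since 1 is compact, two such complemented elements cover it.

   The multiplicative laws come from the algebra of pairs of a congruence b, a subalgebra of
   A^2, and its congruence [delta a], generated by identifying (x, x) with (y, y) whenever
   a x y. Centrality says that [delta a] saturates the pairs lying in d. The shifting lemma,
   applied to [delta a] and the two projection kernels, shows that centrality is symmetric
   and monotone in d; semidegeneracy makes [delta 1] trivial, whence [1, a] = a. *)
From HB Require Import structures.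
From mathcomp Require Import all_boot all_order boolp classical_sets.
Require Import Defs.

Set Implicit Arguments.
Unset Strict Implicit.
Unset Printing Implicit Defensive.

Import Order.LTheory.
Local Open Scope classical_set_scope.

(** * Multiplicative lattices *)

Section RelativeComplements.
Local Open Scope order_scope.
Variables (disp : Order.disp_t) (L : tbLatticeType disp).
Implicit Types a b t : L.

Definition complements t a b := a `&` b = t /\ a `|` b = \top.

Definition complemented a := exists b, complements \bot a b.

Lemma complements_sym t a b : complements t a b -> complements t b a.
Proof. by rewrite /complements meetC joinC. Qed.

Lemma complements01 : complements \bot (\bot : L) \top.
Proof. by split; rewrite ?meet0x ?join0x. Qed.

Lemma complemented0 : complemented (\bot : L).
Proof. by exists \top; exact: complements01. Qed.

Lemma complemented1 : complemented (\top : L).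
Proof. by exists \bot; apply: complements_sym; exact: complements01. Qed.

End RelativeComplements.

Arguments complemented {disp L} a.

Lemma mem_In (T : eqType) (x : T) s : x \in s -> List.In x s.
Proof.
elim: s => [|y s IH] //; rewrite inE => /orP[/eqP ->|/IH]; first by left.
by right.
Qed.

Section Directed.
Local Open Scope order_scope.
Variables (disp : Order.disp_t) (L : porderType disp).
Implicit Type D : set L.

Definition directed D :=
  (exists a, D a) /\ forall a b, D a -> D b -> exists2 c, D c & a <= c /\ b <= c.

Lemma directed_list_ub D J (F : J -> L) s :
  directed D -> (forall j, List.In j s -> D (F j)) ->
  exists2 c, D c & forall j, List.In j s -> F j <= c.
Proof.
move=> [[a0 Da0] dirD]; elim: s => [|j s IH] DF; first by exists a0.
have [i si|c Dc ubc] := IH; first by apply: DF; right.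
have [|e De [Fje ce]] := dirD (F j) c _ Dc; first by apply: DF; left.
by exists e => // i [<-//|/ubc ic]; exact: le_trans ce.
Qed.

Lemma directed_fin_ub D (I : finType) (F : I -> L) :
  directed D -> (forall i, D (F i)) -> exists2 c, D c & forall i, F i <= c.
Proof.
move=> dirD DF; have [//|c Dc ubc] := directed_list_ub (F := F) (s := enum I) dirD.
by exists c => // i; apply: ubc; apply: mem_In; rewrite mem_enum.
Qed.

End Directed.

Section DirectedJoins.
Local Open Scope order_scope.
Variables (disp : Order.disp_t) (L : tbLatticeType disp).
Implicit Types (a : L) (D P : set L).

Definition below P a := [set c | P c /\ c <= a].

Lemma directed_below P a : P \bot -> (forall c c', P c -> P c' -> P (c `|` c')) ->
  directed (below P a).
Proof.
move=> P0 PU; split=> [|c c' [Pc ca] [Pc' c'a]].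
  by exists \bot; split=> //; exact: le0x.
exists (c `|` c'); last by rewrite leUl leUr.
by split; [exact: PU|rewrite leUx ca].
Qed.

Lemma directed_joins D D' : directed D -> directed D' ->
  directed [set a `|` b | a in D & b in D'].
Proof.
move=> [[a Da] dirD] [[b D'b] dirD'].
split=> [|_ _ [a1 Da1 [b1 Db1 <-]] [a2 Da2 [b2 Db2 <-]]].
  by exists (a `|` b), a => //; exists b.
have [a3 Da3 [a13 a23]] := dirD _ _ Da1 Da2; have [b3 Db3 [b13 b23]] := dirD' _ _ Db1 Db2.
by exists (a3 `|` b3); [exists a3 => //; exists b3|rewrite !leU2].
Qed.

End DirectedJoins.

Section CompleteLattice.
Local Open Scope order_scope.
Variables (disp : Order.disp_t) (L : tbLatticeType disp) (bigjoin : set L -> L).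
Hypothesis bigjoinP : forall D c, bigjoin D <= c <-> ubound D c.
Implicit Types (a b c t : L) (D : set L).

Definition compact_element c :=
  forall D, directed D -> c <= bigjoin D -> exists2 a, D a & c <= a.

Definition maximal m := m != \top /\ forall a, m <= a -> a = m \/ a = \top.

Lemma bigjoin_ub D a : D a -> a <= bigjoin D.
Proof. by apply: (proj1 (bigjoinP D _)). Qed.

Lemma compact_element_join a b :
  compact_element a -> compact_element b -> compact_element (a `|` b).
Proof.
move=> ca cb D [D0 dirD]; rewrite leUx => /andP[/(ca D (conj D0 dirD))[x Dx ax]].
move=> /(cb D (conj D0 dirD))[y Dy yb]; have [z Dz [xz yz]] := dirD x y Dx Dy.
by exists z; rewrite // leUx (le_trans ax xz) (le_trans yb yz).
Qed.

Lemma compact_element0 : compact_element \bot.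
Proof. by move=> D [[a Da] _] _; exists a; rewrite ?le0x. Qed.

Lemma directed_compacts_below a : directed (below compact_element a).
Proof.
by apply: directed_below; [exact: compact_element0|exact: compact_element_join].
Qed.

Lemma compact_le_join_bigjoin c t D : compact_element c -> directed D ->
  c <= t `|` bigjoin D -> exists2 a, D a & c <= t `|` a.
Proof.
move=> kc [[a0 Da0] dirD] ctD.
have dirtD : directed [set t `|` a | a in D].
  split=> [|_ _ [a Da <-] [b Db <-]]; first by exists (t `|` a0), a0.
  have [e De [ae be]] := dirD a b Da Db.
  by exists (t `|` e); [exists e|rewrite !leU2].
have [|_ [a Da <-] cta] := kc _ dirtD; last by exists a.
apply: le_trans ctD _; rewrite leUx (le_trans (leUl t a0)) /=.
  by apply/bigjoinP => a Da; apply: le_trans (leUr a t) _; apply: bigjoin_ub; exists a.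
by apply: bigjoin_ub; exists a0.
Qed.

Hypothesis algebraic : forall a, a <= bigjoin (below compact_element a).
Hypothesis compact_top : compact_element \top.

Lemma compact_le_join c f g : compact_element c -> c <= f `|` g ->
  exists2 f0, below compact_element f f0 & c <= f0 `|` g.
Proof.
move=> kc cfg; have [|f0 f0f cgf0] :=
  compact_le_join_bigjoin (t := g) kc (directed_compacts_below f).
  by apply: le_trans cfg _; rewrite joinC leU2 ?algebraic.
by exists f0; rewrite // joinC.
Qed.

Lemma compact_cover f g : f `|` g = \top -> exists f0 g0,
  [/\ below compact_element f f0, below compact_element g g0 & f0 `|` g0 = \top].
Proof.
move=> fg; have [|f0 f0f f0g] := compact_le_join (f := f) (g := g) compact_top.
  by rewrite fg.
rewrite joinC in f0g; have [g0 g0g g0f0] := compact_le_join compact_top f0g.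
by exists f0, g0; split=> //; apply/eqP; rewrite joinC -le1x.
Qed.

Lemma maximal_above a : a != \top -> exists2 m, maximal m & a <= m.
Proof.
move=> aN1; pose T := {b : L | a <= b /\ b != \top}.
pose R (x y : T) := sval x <= sval y.
have [|x y z|x y xy yx|C totC|[m [am mN1]] mmax] := @Zorn T R.
- by move=> x; exact: lexx.
- exact: le_trans.
- apply: eq_sig_hprop; first by move=> ? ? ?; exact: Prop_irrelevance.
  by apply/le_anti; rewrite [_ <= _]xy [_ <= _]yx.
- have [[x0 Cx0]|C0] := pselect (exists x, C x); last first.
    by exists (exist _ a (conj (lexx a) aN1)) => x Cx; case: C0; exists x.
  pose D := [set sval x | x in C].
  have dirD : directed D.
    split=> [|_ _ [x Cx <-] [y Cy <-]]; first by exists (sval x0), x0.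
    have [xy|yx] := totC _ _ Cx Cy; first by exists (sval y); [exists y|].
    by exists (sval x); [exists x|].
  have ubD x : C x -> sval x <= bigjoin D by move=> Cx; apply: bigjoin_ub; exists x.
  have aD : a <= bigjoin D by apply: le_trans (ubD _ Cx0); case: (svalP x0).
  have DN1 : bigjoin D != \top.
    apply/negP; rewrite -le1x => /(compact_top dirD)[_ [x _ <-]].
    by rewrite le1x; apply/negP; case: (svalP x).
  by exists (exist _ (bigjoin D) (conj aD DN1) : T).
exists m => //; split=> // b mb; have [->|bN1] := eqVneq b \top; [by right|left].
pose b' : T := exist _ b (conj (le_trans am mb) bN1).
by have := mmax b' mb => /(congr1 sval).
Qed.

End CompleteLattice.

Section MultiplicativeLattice.
Local Open Scope order_scope.
Variables (disp : Order.disp_t) (L : tbLatticeType disp) (mul : L -> L -> L).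
Local Notation "a * b" := (mul a b) : order_scope.
Hypotheses (mulC : commutative mul) (mulUl : left_distributive mul Order.join).
Hypothesis mul1x : left_id \top mul.
Implicit Types a b c e f g t : L.

Lemma mulUr : right_distributive mul Order.join.
Proof. by move=> a b c; rewrite !(mulC a) mulUl. Qed.

Lemma mul_le2 a b c e : a <= c -> b <= e -> a * b <= c * e.
Proof.
move=> /join_r ac /join_r be; apply: (@le_trans _ _ (c * b)).
  by rewrite -ac mulUl leUl.
by rewrite -be mulUr leUl.
Qed.

Lemma mul_ler a b : a * b <= b.
Proof. by rewrite -[leRHS]mul1x mul_le2 ?lex1. Qed.

Lemma mul_lel a b : a * b <= a. Proof. by rewrite mulC mul_ler. Qed.

Lemma mul_le_meet a b : a * b <= a `&` b.
Proof. by rewrite lexI mul_lel mul_ler. Qed.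

Lemma le_of_comaximal a b c e : a `|` b = \top -> a * c <= e -> b * c <= e -> c <= e.
Proof. by move=> ab ac bc; rewrite -[c]mul1x -ab mulUl leUx ac. Qed.

Lemma comaximal_meet a b : a `|` b = \top -> a `&` b = a * b.
Proof.
move=> ab; apply/le_anti; rewrite mul_le_meet andbT.
by apply: (le_of_comaximal ab); rewrite 1?(mulC b) mul_le2 ?leIl ?leIr.
Qed.

Lemma comaximal_cancel a b c : a `|` c = \top -> a * b <= c -> b <= c.
Proof. by move=> ac abc; apply: (le_of_comaximal ac abc); exact: mul_lel. Qed.

Lemma complements_mul a b t : complements t a b -> a * b = t.
Proof. by case=> <- /comaximal_meet. Qed.

Lemma complement_least a b c : complements \bot a b -> a `|` c = \top -> b <= c.
Proof.
by move=> /complements_mul ab ac; apply: (comaximal_cancel ac); rewrite ab le0x.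
Qed.

Lemma complement_cancel e e' t x :
  complements \bot e e' -> x <= e' -> x <= t `|` e -> x <= t.
Proof.
move=> ee' xe' xte; have ee'0 := complements_mul ee'.
have ex0 : e * x <= \bot by rewrite -ee'0 mul_le2.
apply: (le_of_comaximal (proj2 ee')); first by apply: le_trans ex0 (le0x _).
apply: le_trans (mul_le2 (lexx e') xte) _.
by rewrite mulUr leUx mul_ler /= (mulC e') ee'0 le0x.
Qed.

Lemma mul_join_le a b t : (a `|` t) * (b `|` t) <= a * b `|` t.
Proof.
by rewrite mulUl leUx mulUr leUx leUl /= !lexUr ?mul_lel ?mul_ler.
Qed.

Lemma comaximal_complements a b t :
  a `|` b = \top -> a * b <= t -> complements t (a `|` t) (b `|` t).
Proof.
move=> ab abt; have abtt : (a `|` t) `|` (b `|` t) = \top.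
  by rewrite joinACA ab join1x.
split=> //; apply/le_anti; rewrite lexI !leUr !andbT comaximal_meet //.
by apply: le_trans (mul_join_le a b t) _; rewrite leUx abt lexx.
Qed.

Lemma complemented_join a b : complemented a -> complemented b -> complemented (a `|` b).
Proof.
move=> [a' aa'] [b' bb']; exists (a' `&` b').
have a'le : a' <= (a `|` b) `|` (a' `&` b').
  apply: (le_of_comaximal (proj2 bb')).
    by rewrite -joinA lexUr // lexUl // mul_lel.
  by rewrite lexUr // meetC mul_le_meet.
have cover : (a `|` b) `|` (a' `&` b') = \top.
  by apply/eqP; rewrite -le1x -(proj2 aa') leUx a'le -joinA leUl.
split=> //; apply/eqP; rewrite -lex0 comaximal_meet // mulUl leUx.
have -> : a * (a' `&` b') <= \bot by rewrite -(complements_mul aa') mul_le2 ?leIl.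
by rewrite -(complements_mul bb') mul_le2 ?leIr.
Qed.

Lemma directed_complemented_below a : directed (below complemented a).
Proof. by apply: directed_below; [exact: complemented0|exact: complemented_join]. Qed.

Definition lifts t := forall a b, complements t a b ->
  exists e e', complements \bot e e' /\ e `|` t = a.

Definition splitting t a b := exists e e',
  [/\ complements \bot e e', e <= t `|` a & e' <= t `|` b].

Definition splits t := forall a b, a `|` b = \top -> a * b <= t -> splitting t a b.

Lemma lifts_splits t : lifts t -> splits t.
Proof.
move=> lift a b ab abt.
have [e [e' [ee' et]]] := lift _ _ (comaximal_complements ab abt).
exists e, e'; rewrite (joinC t) -et leUl; split=> //.
apply: (complement_least ee'); apply/le_anti.
by rewrite lex1 joinA et -ab leU2 ?leUl ?leUr.
Qed.

Lemma splits_lifts t : splits t -> lifts t.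
Proof.
move=> sp a b abt; have [tE ab] := abt.
have ta : t <= a by rewrite -tE leIl.
have tb : t <= b by rewrite -tE leIr.
have [|e [e' [ee' ea e'b]]] := sp a b ab; first by rewrite (complements_mul abt).
rewrite (join_r ta) in ea; rewrite (join_r tb) in e'b.
exists e, e'; split=> //; apply/le_anti; rewrite leUx ea ta /=.
apply: (le_of_comaximal (proj2 ee')); first by rewrite lexUl ?mul_lel.
by rewrite lexUr // mulC -(complements_mul abt) mul_le2.
Qed.

Lemma splits_of_eq t :
  (forall a b, a `|` b = \top -> a * b = t -> splitting t a b) -> splits t.
Proof.
move=> sp a b ab abt; have abc := comaximal_complements ab abt.
have [e [e' [ee' ea e'b]]] := sp _ _ (proj2 abc) (complements_mul abc).
have absorb x : t `|` (x `|` t) = t `|` x by rewrite joinCA joinxx joinC.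
by exists e, e'; rewrite -(absorb a) -(absorb b).
Qed.

Lemma maximal_complement m e e' :
  maximal m -> complements \bot e e' -> e <= m \/ e' <= m.
Proof.
move=> [_ mmax] ee'; have [em|em] := mmax _ (leUr m e); first by left; rewrite -em leUl.
by right; exact: complement_least ee' em.
Qed.

(* Replacing [b] by [e' * b], with e' the complement of e, pushes the product [a * b]
   from below [t `|` e] to below [t]. *)
Lemma splits_modulo t e a b : splits t -> complemented e ->
  a `|` b = \top -> a * b <= t `|` e -> splitting t (e `|` a) b.
Proof.
move=> sp [e' ee'] ab abte; have ee'0 := complements_mul ee'.
have b_le : b <= e `|` e' * b.
  by apply: (le_of_comaximal (proj2 ee')); rewrite ?leUr // lexUl // mul_lel.
have [||f [f' [ff' fa f'b]]] := sp (e `|` a) (e' * b).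
- apply/eqP; rewrite -le1x -ab leUx lexUl ?leUr //=.
  by rewrite (le_trans b_le) // leU2 ?leUl.
- rewrite mulUl leUx; apply/andP; split.
    by rewrite (le_trans (mul_le2 (lexx e) (mul_lel e' b))) // ee'0 le0x.
  apply: (complement_cancel ee'); first by rewrite (le_trans (mul_ler _ _)) ?mul_lel.
  by rewrite (le_trans _ abte) // mul_le2 ?mul_ler.
exists f, f'; split=> //; apply: le_trans f'b _.
by rewrite leU2 ?mul_ler.
Qed.

Section Algebraic.
Variable bigjoin : set L -> L.
Hypothesis bigjoinP : forall D c, bigjoin D <= c <-> ubound D c.
Hypothesis algebraic : forall a, a <= bigjoin (below (compact_element bigjoin) a).
Hypothesis compact_top : compact_element bigjoin \top.

Definition locally_indecomposable t := forall m, maximal m ->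
  forall a b, complements (t `|` bigjoin (below complemented m)) a b ->
  a = \top \/ b = \top.

Hypothesis compact_mul :
  forall a b, compact_element bigjoin a -> compact_element bigjoin b ->
  compact_element bigjoin (a * b).

Lemma splits_locally_indecomposable t : splits t -> locally_indecomposable t.
Proof.
move=> sp m mm f g fg; set s := t `|` _ in fg; have [sE fgN1] := fg.
have [ts sf sg] : [/\ t <= s, s <= f & s <= g] by rewrite -sE leIl leIr sE leUl.
have ds e : below complemented m e -> e <= s.
  by move=> em; rewrite lexUr // (bigjoin_ub bigjoinP).
have [f0 [g0 [[kf0 f0f] [kg0 g0g] f0g0]]] :=
  compact_cover bigjoinP algebraic compact_top fgN1.
have [|e em f0g0e] := compact_le_join_bigjoin bigjoinP (t := t)
    (compact_mul kf0 kg0) (directed_complemented_below m).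
  by rewrite -/s -(complements_mul fg) mul_le2.
have [x [x' [xx' xf x'g]]] := splits_modulo sp (proj1 em) f0g0 f0g0e.
have {}xf : x <= f.
  by rewrite (le_trans xf) // !leUx f0f (le_trans ts sf) (le_trans (ds e em) sf).
have {}x'g : x' <= g by rewrite (le_trans x'g) // leUx g0g (le_trans ts sg).
have [xm|x'm] := maximal_complement mm xx'; [right|left];
    apply/eqP; rewrite -le1x -(proj2 xx').
  by rewrite leUx x'g andbT (le_trans _ sg) // ds //; split=> //; exists x'.
rewrite leUx xf (le_trans _ sf) // ds //; split=> //; exists x.
exact: complements_sym.
Qed.

Lemma complemented_not_le m f : m != \top ->
  f `|` bigjoin (below complemented m) = \top ->
  exists2 e, below complemented f e & ~~ (e <= m).
Proof.
move=> mN1 fm; have [|e [[e' ee'] em] fe] :=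
  compact_le_join_bigjoin bigjoinP (t := f) compact_top (directed_complemented_below m).
  by rewrite fm.
exists e'; first split.
- by exists e; exact: complements_sym.
- by apply: (complement_least ee'); apply/eqP; rewrite joinC -le1x.
by apply: contra mN1 => e'm; rewrite -le1x -(proj2 ee') leUx em.
Qed.

Lemma locally_indecomposable_splits t : locally_indecomposable t -> splits t.
Proof.
move=> loc a b ab abt; pose f := t `|` a; pose g := t `|` b.
pose D := [set x `|` y | x in below complemented f & y in below complemented g].
have dirD : directed D by apply: directed_joins; exact: directed_complemented_below.
have D1 : \top <= bigjoin D.
  rewrite le1x; apply/negPn/negP => /(maximal_above bigjoinP compact_top)[m mm Dm].
  have escape h : h = f \/ h = g -> h `|` bigjoin (below complemented m) = \top -> False.
    move=> hfg /(complemented_not_le (proj1 mm))[e eh].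
    move/negP; apply; apply: le_trans Dm; apply: (bigjoin_ub bigjoinP).
    have b0 k : below complemented k \bot by split; [exact: complemented0|exact: le0x].
    case: hfg eh => -> eh; first by exists e => //; exists \bot; rewrite ?joinx0.
    by exists \bot => //; exists e; rewrite ?join0x.
  have abs : a * b <= t `|` bigjoin (below complemented m) by rewrite lexUl.
  have [E|E] := loc m mm _ _ (comaximal_complements ab abs).
    by apply: (escape f); [left|rewrite /f -E joinA (joinC a)].
  by apply: (escape g); [right|rewrite /g -E joinA (joinC b)].
have [_ [x [[x' xx'] xf] [y [_ yg] <-]] xy] := compact_top dirD D1.
exists x, x'; split=> //; apply: le_trans yg.
by apply: (complement_least xx'); apply/eqP; rewrite -le1x.
Qed.

Theorem lifts_tfae t : [<-> lifts t; splits t;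
  forall a b, a `|` b = \top -> a * b = t -> splitting t a b;
  locally_indecomposable t].
Proof.
tfae.
- exact: lifts_splits.
- by move=> sp a b ab abt; apply: sp; rewrite ?abt.
- by move/splits_of_eq; exact: splits_locally_indecomposable.
- by move/locally_indecomposable_splits; exact: splits_lifts.
Qed.

End Algebraic.
End MultiplicativeLattice.

(** * Congruence lattices *)

Record congruence (S : signature) (A : algebra S) := Congruence {
  con_rel :> A -> A -> Prop;
  con_relP : is_con con_rel }.

Fact congruence_display : Order.disp_t. Proof. exact: Order.Disp tt tt. Qed.

Section CongruenceLattice.
Local Open Scope order_scope.
Variables (S : signature) (A : algebra S).
Implicit Types (a b c : congruence A) (R : prel A).

Lemma con_refl a x : a x x. Proof. by have [reflR _] := con_relP a; exact: reflR. Qed.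

Lemma con_sym a x y : a x y -> a y x.
Proof. by have [_ [symR _]] := con_relP a; exact: symR. Qed.

Lemma con_trans a y x z : a x y -> a y z -> a x z.
Proof. by have [_ [_ [trR _]]] := con_relP a; exact: trR. Qed.

Lemma con_op a (i : sym S) (f g : 'I_(ar i) -> A) :
  (forall k, a (f k) (g k)) -> a (op f) (op g).
Proof. by have [_ [_ [_ opR]]] := con_relP a; exact: opR. Qed.

Lemma prel_ext R R' : releq R R' -> R = R'.
Proof. by move=> RR'; apply/funext=> x; apply/funext=> y; apply/propext. Qed.

Lemma con_eqP a b : a = b <-> releq a b.
Proof.
split=> [->|]; first by [].
case: a b => [R cR] [R' cR'] /= /prel_ext RR'; case: R' / RR' in cR' *.
by rewrite (Prop_irrelevance cR cR').
Qed.

Lemma is_con_delta : is_con (@Delta A).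
Proof.
split=> [x|]; first by [].
split=> [x y ->//|]; split=> [x y z -> ->//|i f g fg].
by rewrite (funext fg).
Qed.

Lemma is_con_nabla : is_con (@Nabla A). Proof. by []. Qed.

Lemma is_con_meet a b : is_con (meet a b).
Proof.
split=> [x|]; first by split; exact: con_refl.
split=> [x y [? ?]|]; first by split; exact: con_sym.
split=> [x y z [axy bxy] [ayz byz]|i f g fg].
  by split; [exact: con_trans axy ayz|exact: con_trans bxy byz].
by split; apply: con_op => k; case: (fg k).
Qed.

Lemma is_con_bigmeet (P : prel A -> Prop) :
  is_con (fun x y => forall R, is_con R -> P R -> R x y).
Proof.
split=> [x R cR _|]; first exact: (con_refl (Congruence cR)).
split=> [x y xy R cR PR|]; first by apply: (@con_sym (Congruence cR)); exact: xy.
split=> [x y z xy yz R cR PR|i f g fg R cR PR].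
  by apply: (@con_trans (Congruence cR) y); [exact: xy|exact: yz].
by apply: (@con_op (Congruence cR)) => k; exact: fg.
Qed.

Definition con_gen R : congruence A := Congruence (is_con_bigmeet (psubrel R)).

Definition con_le a b : bool := `[< psubrel a b >].

Lemma con_le_refl : reflexive con_le.
Proof. by move=> a; apply/asboolP. Qed.

Lemma con_le_anti : antisymmetric con_le.
Proof.
move=> a b /andP[/asboolP ab /asboolP ba].
by apply/con_eqP => x y; split; [exact: ab|exact: ba].
Qed.

Lemma con_le_trans : transitive con_le.
Proof.
by move=> b a c /asboolP ab /asboolP bc; apply/asboolP => x y /ab; exact: bc.
Qed.

HB.instance Definition _ := gen_eqMixin (congruence A).
HB.instance Definition _ := gen_choiceMixin (congruence A).
HB.instance Definition _ := Order.Le_isPOrder.Build congruence_display (congruence A)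
  con_le_refl con_le_anti con_le_trans.

Lemma con_leP a b : reflect (psubrel a b) (a <= b).
Proof. exact: asboolP. Qed.

Lemma con_gen_leP R c : reflect (psubrel R c) (con_gen R <= c).
Proof.
apply: (iffP (con_leP _ _)) => Rc x y xy; first by apply: Rc => c' _; exact.
by apply: xy Rc; exact: con_relP.
Qed.

Lemma con_gen_ub R : psubrel R (con_gen R).
Proof. by apply/con_gen_leP. Qed.

(* The lattice operations and bounds unfold to [meet], [join], [Delta] and [Nabla], so that
   lattice identities are literally statements about the underlying relations. *)
Definition con_meet a b := Congruence (is_con_meet a b).

Definition con_join a b := con_gen (fun x y => a x y \/ b x y).

Lemma con_meetP a b c : (a <= con_meet b c) = (a <= b) && (a <= c).
Proof.
apply/con_leP/andP => [abc|[/con_leP ab /con_leP ac] x y axy].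
  by split; apply/con_leP => x y /abc[].
by split; [exact: ab|exact: ac].
Qed.

Lemma con_joinP a b c : (con_join a b <= c) = (a <= c) && (b <= c).
Proof.
apply/con_gen_leP/andP => [abc|[/con_leP ac /con_leP bc] x y [/ac|/bc]//].
by split; apply/con_leP => x y xy; apply: abc; [left|right].
Qed.

HB.instance Definition _ := Order.POrder_MeetJoin_isLattice.Build
  congruence_display (congruence A) con_meetP con_joinP.

Lemma con_delta_le a : Congruence is_con_delta <= a.
Proof. by apply/con_leP => x y ->; exact: con_refl. Qed.

Lemma con_le_nabla a : a <= Congruence is_con_nabla.
Proof. exact/con_leP. Qed.

HB.instance Definition _ :=
  Order.hasBottom.Build congruence_display (congruence A) con_delta_le.
HB.instance Definition _ :=
  Order.hasTop.Build congruence_display (congruence A) con_le_nabla.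

Definition con_bigjoin (D : set (congruence A)) : congruence A :=
  con_gen (fun x y => exists2 a, D a & a x y).

Lemma con_bigjoinP D c : con_bigjoin D <= c <-> ubound D c.
Proof.
split=> [/con_gen_leP Dc a Da|Dc]; first by apply/con_leP => x y axy; apply: Dc; exists a.
by apply/con_gen_leP => x y [a /Dc/con_leP]; apply.
Qed.

Lemma le_con a b x y : a <= b -> a x y -> b x y.
Proof. by move=> /con_leP; apply. Qed.

Lemma con_joinl a b x y : a x y -> (a `|` b) x y.
Proof. exact/le_con/leUl. Qed.

Lemma con_joinr a b x y : b x y -> (a `|` b) x y.
Proof. exact/le_con/leUr. Qed.

Lemma con_join_modular a b c : modular_con A -> a <= c ->
  (a `|` b) `&` c <= a `|` (b `&` c).
Proof.
move=> modA /con_leP ac; apply/con_leP => x y.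
exact: (proj2 (modA _ _ _ (con_relP a) (con_relP b) (con_relP c) ac x y)).
Qed.

Lemma modular_shifting a b c x y z u : modular_con A -> a `&` b <= c ->
  a x z -> a y u -> b x y -> b z u -> c x y -> c z u.
Proof.
move=> modA abc xz yu xy zu cxy.
have : ((b `&` c) `|` a) `&` b <= c.
  apply: le_trans (con_join_modular a modA (leIl b c)) _.
  by rewrite leUx leIr abc.
move/le_con; apply; split=> //.
apply: (@con_trans _ x); first by apply: con_joinr; exact: con_sym.
by apply: (@con_trans _ y); [exact: con_joinl|exact: con_joinr].
Qed.

Lemma con_bigjoin_directed (D : set (congruence A)) x y :
  directed D -> con_bigjoin D x y -> exists2 a, D a & a x y.
Proof.
move=> dirD; have [[a0 Da0] dirD2] := dirD.
suff cU : is_con (fun x y => exists2 a, D a & a x y).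
  by move=> xy; exact: (xy _ cU).
split=> [u|]; first by exists a0 => //; exact: con_refl.
split=> [u v [a Da uv]|]; first by exists a => //; exact: con_sym.
split=> [u v w [a Da uv] [b Db vw]|i f g fg].
  have [c Dc [ac bc]] := dirD2 a b Da Db.
  by exists c => //; exact: con_trans (le_con ac uv) (le_con bc vw).
have /choice[F DF] : forall k, exists a, D a /\ a (f k) (g k).
  by move=> k; have [a Da fga] := fg k; exists a.
have [|c Dc Fc] := directed_fin_ub (F := F) dirD; first by move=> k; case: (DF k).
by exists c => //; apply: con_op => k; apply: le_con (Fc k) (proj2 (DF k)).
Qed.

Local Notation compact_element := (compact_element con_bigjoin).

Definition principal x y : congruence A := con_gen (fun u v => u = x /\ v = y).

Lemma principal_leP x y c : principal x y <= c <-> c x y.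
Proof.
split=> [/con_gen_leP|cxy]; first by apply.
by apply/con_gen_leP => _ _ [-> ->].
Qed.

Lemma compact_principal x y : compact_element (principal x y).
Proof.
move=> D dirD /principal_leP /(con_bigjoin_directed dirD)[a Da axy].
by exists a => //; apply/principal_leP.
Qed.

Lemma con_algebraic a : a <= con_bigjoin (below compact_element a).
Proof.
apply/con_leP => x y axy; apply/principal_leP.
apply: (bigjoin_ub con_bigjoinP); split; first exact: compact_principal.
exact/principal_leP.
Qed.

Lemma compactP a : compact a <-> compact_element a.
Proof.
split=> [[_ cpt] D dirD /con_leP aD|cpt].
  have [j|x y /aD|s a_le] := cpt {c | D c} (fun j => sval j); first exact: con_relP.
    apply: (@le_con (con_bigjoin D) (con_gen _)); apply/con_gen_leP => u v [c Dc uv].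
    by apply: con_gen_ub; exists (exist _ c Dc).
  have [c Dc sc] :=
    directed_list_ub (F := sval) dirD (fun j (_ : List.In j s) => svalP j).
  exists c => //; apply/con_leP => x y /a_le xy.
  by apply: xy (con_relP c) _ => u v [j [/sc/le_con]]; apply.
split=> [|J F cF aF]; first exact: con_relP.
pose sub s := con_gen (fun x y => exists j, List.In j s /\ F j x y).
have sub_le s s' : (forall j, List.In j s -> List.In j s') -> sub s <= sub s'.
  move=> ss'; apply/con_gen_leP => x y [j [/ss' js Fxy]].
  by apply: con_gen_ub; exists j.
have dir_sub : directed (range sub).
  split=> [|_ _ [s _ <-] [s' _ <-]]; first by exists (sub [::]), [::].
  by exists (sub (s ++ s')); [exists (s ++ s')|split; apply: sub_le => j js;
    apply/List.in_or_app; [left|right]].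
have [|_ [s _ <-] as_] := cpt _ dir_sub; last by exists s; move/con_leP: as_.
apply/con_leP => x y /aF; apply: (@le_con (con_gen _) (con_bigjoin _)).
apply/con_gen_leP => u v [j Fuv].
apply: (le_con (bigjoin_ub con_bigjoinP (imageT sub [:: j]))).
by apply: con_gen_ub; exists j; split=> //; left.
Qed.

End CongruenceLattice.

Section Complements.
Local Open Scope order_scope.
Variables (S : signature) (A : algebra S).
Implicit Types (a b : congruence A) (R : prel A).

Lemma is_complP a b : is_compl a b <-> complements \bot a b.
Proof.
have [meetP joinP] := (con_eqP (a `&` b) \bot, con_eqP (a `|` b) \top).
split=> [[_ [_ [/meetP ab0 /joinP ab1]]]|[/meetP ab0 /joinP ab1]]; first by split.
by do 2![split; first exact: con_relP].
Qed.

Lemma booleanP R : boolean R <-> exists2 e : congruence A, complemented e & R = e.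
Proof.
split=> [[R' RR']|[e [e' ee'] ->]]; last by exists e'; apply/is_complP.
have [cR [cR' _]] := RR'.
by exists (Congruence cR) => //; exists (Congruence cR'); apply/is_complP.
Qed.

Lemma at_most_two_booleanP : at_most_two_boolean A <->
  forall a b, complements \bot a b -> a = \top \/ b = \top.
Proof.
split=> [two a b ab|two _ _ _ /booleanP[a ba ->] /booleanP[b bb ->] /booleanP[c bc ->]].
  have ba : complemented a by exists b.
  have bool (e : congruence A) : complemented e -> boolean e.
    by move=> be; apply/booleanP; exists e.
  have [] := two _ _ _ (bool _ (complemented0 _)) (bool _ (complemented1 _)) (bool _ ba).
    by move/(con_eqP \bot \top) => top0; left; apply/eqP; rewrite -le1x -top0 le0x.
  case=> [/(con_eqP \bot a) a0|/(con_eqP \top a)]; last by left.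
  by right; case: ab => _; rewrite -a0 join0x.
have {}two (e : congruence A) : complemented e -> e = \bot \/ e = \top.
  case=> e' ee'; have [->|e'1] := two _ _ ee'; [by right|left].
  by case: ee'; rewrite e'1 meetx1.
by case: (two a ba) => ->; case: (two b bb) => ->; case: (two c bc) => ->;
  by [left|right; left|right; right].
Qed.

Lemma maximal_conP a : maximal_con a <-> maximal a.
Proof.
split=> [[_ [aN1 amax]]|[aN1 amax]].
  split=> [|b /con_leP ab]; first by apply/eqP => /con_eqP.
  by have [/(con_eqP b a)|/(con_eqP b \top)] := amax b (con_relP b) ab; [left|right].
split; first exact: con_relP.
split=> [|R cR aR]; first by move/(con_eqP a \top)/eqP; apply/negP.
have [|Ra|R1] := amax (Congruence cR); first exact/con_leP.
  by left; apply/(con_eqP (Congruence cR) a).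
by right; apply/(con_eqP (Congruence cR) \top).
Qed.

Lemma diamondE a : diamond a = con_bigjoin (below complemented a).
Proof.
apply: prel_ext => x y; split.
  apply: (@le_con _ _ (con_gen _) (con_bigjoin _)).
  apply/con_gen_leP => u v [R [bR [Ra Ruv]]].
  have /booleanP[e be eR] := bR; rewrite {}eR in Ra Ruv.
  by apply: con_gen_ub; exists e => //; split=> //; apply/con_leP.
apply: (@le_con _ _ (con_bigjoin _) (con_gen _)).
apply/con_bigjoinP => e [be /con_leP ea]; apply/con_leP => u v euv.
by apply: con_gen_ub; exists e; split=> //; apply/booleanP; exists e.
Qed.

End Complements.

Section Preimage.
Variables (S : signature) (A B : algebra S) (h : A -> B).

Definition morphism := forall (i : sym S) (f : 'I_(ar i) -> A),
  h (op f) = op (fun k => h (f k)).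

Hypothesis hM : morphism.

Lemma eval_morphism (v : nat -> A) t : eval (fun n => h (v n)) t = h (eval v t).
Proof. by elim: t => [n|i f IH] //=; rewrite hM; congr op; apply/funext. Qed.

Lemma is_con_preim (d : congruence B) : is_con (fun x y => d (h x) (h y)).
Proof.
split=> [x|]; first exact: con_refl.
split=> [x y|]; first exact: con_sym.
split=> [x y z|i f g fg]; first exact: con_trans.
by rewrite !hM; exact: con_op.
Qed.

Definition con_preim (d : congruence B) : congruence A := Congruence (is_con_preim d).

End Preimage.

Section Quotient.
Local Open Scope order_scope.
Variables (S : signature) (A : algebra S) (th : congruence A).
Implicit Types (a b : congruence A) (c d : congruence (quot th)).

Lemma qcar_ext (X Y : quot th) : sval X = sval Y -> X = Y.
Proof. by apply: eq_sig_hprop => ? ? ?; exact: Prop_irrelevance. Qed.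

Lemma cls_eq x y : cls th x = cls th y <-> th x y.
Proof.
split=> [[e]|xy]; first by rewrite e; exact: con_refl.
apply: qcar_ext; apply/funext => z; apply/propext.
by split=> h; [exact: con_trans (con_sym xy) h|exact: con_trans xy h].
Qed.

Lemma repK (X : quot th) : cls th (rep X) = X.
Proof.
rewrite /rep; case: ClassicalEpsilon.constructive_indefinite_description => x /= e.
exact: qcar_ext.
Qed.

Lemma cls_morphism : morphism (cls th : A -> quot th).
Proof. by move=> i f; apply/cls_eq/con_op => k; apply/cls_eq; rewrite repK. Qed.

Lemma models_quot (E : term S -> term S -> Prop) : models E A -> models E (quot th).
Proof.
move=> mA s t st v.
have -> : v = fun n => cls th (rep (v n)) by apply/funext => n; rewrite repK.
by rewrite !(eval_morphism cls_morphism) (mA _ _ st).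
Qed.

Definition pull := con_preim cls_morphism.

Lemma pull_ge c : th <= pull c.
Proof. by apply/con_leP => x y /cls_eq /= ->; exact: con_refl. Qed.

Lemma pull_le c d : (pull c <= pull d) = (c <= d).
Proof.
apply/con_leP/con_leP => cd => [X Y|x y]; last exact: cd.
by rewrite -(repK X) -(repK Y); exact: cd.
Qed.

Lemma pull_inj : injective pull.
Proof. by move=> c d cd; apply/le_anti; rewrite -!pull_le cd lexx. Qed.

Lemma qcon_cls a x y : qcon a (cls th x) (cls th y) <-> (a `|` th) x y.
Proof.
split=> [[u [v [/cls_eq xu [/cls_eq yv uv]]]]|xy]; last by exists x, y.
apply: (@con_trans _ _ _ u); first exact: con_joinr.
by apply: (@con_trans _ _ _ v); [exact: uv|apply: con_joinr; exact: con_sym].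
Qed.

Lemma is_con_qcon a : is_con (@qcon S A th a).
Proof.
have qE (X Y : quot th) : qcon a X Y = (a `|` th) (rep X) (rep Y).
  by rewrite -{1}(repK X) -{1}(repK Y); apply/propext/qcon_cls.
split=> [X|]; first by rewrite qE; exact: con_refl.
split=> [X Y|]; first by rewrite !qE; exact: con_sym.
split=> [X Y Z|i f g fg]; first by rewrite !qE; exact: con_trans.
by apply/qcon_cls/con_op => k; rewrite -qE.
Qed.

Definition push a : congruence (quot th) := Congruence (is_con_qcon a).

Lemma push_pull a : pull (push a) = a `|` th.
Proof. by apply/con_eqP => x y; exact: qcon_cls. Qed.

Lemma pull_push a : th <= a -> pull (push a) = a.
Proof. by move=> tha; rewrite push_pull join_l. Qed.

Lemma pullU c d : pull (c `|` d) = pull c `|` pull d.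
Proof.
apply/le_anti; rewrite leUx !pull_le leUl leUr andbT.
have thcd : th <= pull c `|` pull d by rewrite lexUl ?pull_ge.
by rewrite -(pull_push thcd) pull_le leUx -!pull_le pull_push // leUl leUr.
Qed.

Lemma pull0 : pull \bot = th.
Proof. by apply/con_eqP => x y; exact: cls_eq. Qed.

Lemma pull1 : pull \top = \top.
Proof. exact/con_eqP. Qed.

Lemma pullI c d : pull (c `&` d) = pull c `&` pull d.
Proof. exact/con_eqP. Qed.

Lemma complements_pull c d : complements th (pull c) (pull d) <-> complements \bot c d.
Proof.
rewrite /complements -pullI -pullU; split=> [[cd0 cd1]|[-> ->]].
  by split; apply: pull_inj; rewrite ?pull0 ?pull1.
by rewrite pull0 pull1.
Qed.

Lemma CBLP_lifts : CBLP th <-> lifts th.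
Proof.
split=> [lift a b [abth ab1]|lift _ /booleanP[c [d cd] ->]].
  have tha : th <= a by rewrite -abth leIl.
  have thb : th <= b by rewrite -abth leIr.
  have [|R [/booleanP[e [e' ee'] ->] /(con_eqP (push e) (push a)) ea]] := lift (push a).
    by apply/booleanP; exists (push a) => //; exists (push b);
      apply/complements_pull; rewrite !pull_push.
  by exists e, e'; rewrite -(push_pull e) -(pull_push tha); split=> //; congr pull.
have [e [e' [ee' ec]]] := lift _ _ (proj2 (complements_pull c d) cd).
exists e; split; first by apply/booleanP; exists e => //; exists e'.
have <- : push e = c by apply: pull_inj; rewrite push_pull.
by [].
Qed.

End Quotient.

(** * The commutator *)

Section TransitiveClosure.
Variables (S : signature) (A : algebra S).
Implicit Types (R : prel A) (P : A -> Prop).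

Fixpoint chain R n : prel A :=
  if n is n'.+1 then fun x z => exists2 y, R x y & chain R n' y z else @Delta A.

Definition tclos R : prel A := fun x y => exists n, chain R n x y.

Lemma chain_cat R m n y x z : chain R m x y -> chain R n y z -> chain R (m + n) x z.
Proof.
elim: m x => [|m IH] x /=; first by move=> ->.
by case=> w xw wy yz; exists w => //; exact: IH.
Qed.

Lemma chain_pad R m n x y : (forall z, R z z) -> m <= n ->
  chain R m x y -> chain R n x y.
Proof.
move=> Rxx /subnKC <- xy; apply: chain_cat xy _.
by elim: (n - m) => [|k IH] //=; exists y.
Qed.

Lemma tclos_sub R : psubrel R (tclos R).
Proof. by move=> x y Rxy; exists 1; exists y. Qed.

(* Reflexivity lets chains be padded to a common length, so that the transitive
   closure inherits compatibility with operations of any finite arity. *)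
Lemma is_con_tclos R : (forall x, R x x) -> (forall x y, R x y -> R y x) ->
  (forall i (f g : 'I_(ar i) -> A), (forall k, R (f k) (g k)) -> R (op f) (op g)) ->
  is_con (tclos R).
Proof.
move=> Rxx Rsym Rop; split=> [x|]; first by exists 0.
split=> [x y [n]|].
  elim: n x => [|n IH] x /=; first by move=> ->; exists 0.
  case=> z /Rsym zx /IH [m yz]; exists (m + 1).
  by apply: chain_cat yz _; exists x.
split=> [x y z [m xy] [n yz]|i f g /choice[N fg]].
  by exists (m + n); exact: chain_cat xy yz.
exists (\max_k N k).
have {}fg k : chain R (\max_k N k) (f k) (g k).
  by apply: chain_pad (fg k) => //; exact: leq_bigmax.
elim: (\max_k _) f fg => [|n IH] f fg /=; first by rewrite (funext fg).
have /choice[e fe] : forall k, exists y, R (f k) y /\ chain R n y (g k).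
  by move=> k; have [y] := fg k; exists y.
by exists (op e); [apply: Rop|apply: IH] => k; case: (fe k).
Qed.

Definition saturated R P := forall x y, R x y -> P x -> P y.

Lemma saturated_tclos R P : saturated R P -> saturated (tclos R) P.
Proof.
move=> RP x y [n]; elim: n x => [|n IH] x /=; first by move=> ->.
by case=> z /RP xz zy /xz; exact: IH.
Qed.

Lemma saturated_join (a b : congruence A) P :
  saturated a P -> saturated b P -> saturated (a `|` b)%O P.
Proof.
move=> aP bP; pose R : prel A := fun x y => exists z w, [/\ a x z, b z w & a w y].
have cR : is_con (tclos R).
  apply: is_con_tclos => [u|u v [z [w [uz zw wv]]]|i f g /choice[z /choice[w fg]]].
  - by exists u, u; split; exact: con_refl.
  - by exists w, z; split; exact: con_sym.
  - by exists (op z), (op w); split; apply: con_op => k; case: (fg k).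
have ab_le : (a `|` b <= Congruence cR)%O.
  rewrite leUx; apply/andP; split; apply/con_leP => x y xy; apply: tclos_sub.
    by exists y, y; split=> //; exact: con_refl.
  by exists x, y; split=> //; exact: con_refl.
move=> x y /(le_con ab_le); apply: saturated_tclos => u v [z [w [uz zw wv]]] Pu.
by apply: (aP _ _ wv); apply: (bP _ _ zw); apply: (aP _ _ uz).
Qed.

End TransitiveClosure.

Section Matrices.
Variables (S : signature) (A : algebra S).
Implicit Types (a b d : congruence A).

(* [matrix a b p q r s] concerns the 2x2 matrix with rows (p, q) and (r, s): its
   columns are a-related and its rows b-related. *)
Inductive matrix a b : A -> A -> A -> A -> Prop :=
  | MatrixCol x y of a x y : matrix a b x x y y
  | MatrixRow u v of b u v : matrix a b u v u v
  | MatrixOp i (p q r s : 'I_(ar i) -> A) of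
      (forall k, matrix a b (p k) (q k) (r k) (s k)) :
      matrix a b (op p) (op q) (op r) (op s).

Definition central a b d := forall p q r s, matrix a b p q r s -> d p q -> d r s.

Lemma matrix_sym a b p q r s : matrix a b p q r s -> matrix a b r s p q.
Proof.
elim=> [x y xy|u v uv|i p0 q0 r0 s0 _ IH].
- by apply: MatrixCol; exact: con_sym.
- exact: MatrixRow.
- exact: MatrixOp.
Qed.

Lemma matrix_tr a b p q r s : matrix a b p q r s -> matrix b a p r q s.
Proof.
elim=> [x y xy|u v uv|i p0 q0 r0 s0 _ IH].
- exact: MatrixRow.
- exact: MatrixCol.
- exact: MatrixOp.
Qed.

Lemma matrix_swap a b p q r s : matrix a b p q r s -> matrix a b q p s r.
Proof.
elim=> [x y xy|u v uv|i p0 q0 r0 s0 _ IH].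
- exact: MatrixCol.
- by apply: MatrixRow; exact: con_sym.
- exact: MatrixOp.
Qed.

Lemma matrix_row a b p q r s : matrix a b p q r s -> b p q /\ b r s.
Proof.
elim=> [x y xy|u v uv|i p0 q0 r0 s0 _ IH] //; first by split; exact: con_refl.
by split; apply: con_op => k; case: (IH k).
Qed.

Lemma matrix_col a b p q r s : matrix a b p q r s -> a p r /\ a q s.
Proof. by move=> /matrix_tr; exact: matrix_row. Qed.

Fixpoint tsubst (u : nat -> term S) (t : term S) : term S :=
  match t with
  | Var n => u n
  | App i f => App (fun k => tsubst u (f k))
  end.

Lemma eval_tsubst (v : nat -> A) u t :
  eval v (tsubst u t) = eval (fun n => eval v (u n)) t.
Proof. by elim: t => //= i f IH; congr op; apply/funext. Qed.

Lemma eval_finite_support (t : term S) :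
  exists N, forall v w : nat -> A, (forall n, n < N -> v n = w n) -> eval v t = eval w t.
Proof.
elim: t => [n|i f /choice[N fN]] /=; first by exists n.+1 => v w; apply.
exists (\max_k N k) => v w vw; congr op; apply/funext => k; apply: fN => n nN.
by apply: vw; apply: leq_trans nN _; exact: leq_bigmax.
Qed.

Lemma matrix_eval a b t m (e e' f f' : nat -> A) :
  (forall n, a (e n) (e' n)) -> (forall n, b (f n) (f' n)) ->
  matrix a b (eval (mixv m e f) t) (eval (mixv m e f') t)
             (eval (mixv m e' f) t) (eval (mixv m e' f') t).
Proof.
move=> ee' ff'; elim: t => [n|i g IH] /=; last by apply: MatrixOp.
by rewrite /mixv; case: ifP => _; [exact: MatrixCol|exact: MatrixRow].
Qed.

Definition generator a b (is_col : bool) p q r s :=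
  if is_col then [/\ p = q, r = s & a p r] else [/\ p = r, q = s & b p q].

(* The variables of the arguments of an operation are kept apart by encoding pairs
   (argument, variable) as integers. *)
Lemma matrix_eval_generators a b p q r s : matrix a b p q r s ->
  exists t is_col (P Q R T : nat -> A),
    (forall n, generator a b (is_col n) (P n) (Q n) (R n) (T n)) /\
    [/\ p = eval P t, q = eval Q t, r = eval R t & s = eval T t].
Proof.
elim=> [x y xy|u v uv|i p0 q0 r0 s0 _].
- by exists (Var _ 0), (fun=> true), (fun=> x), (fun=> x), (fun=> y), (fun=> y).
- by exists (Var _ 0), (fun=> false), (fun=> u), (fun=> v), (fun=> u), (fun=> v).
move=> /choice[t /choice[c /choice[P /choice[Q /choice[R /choice[T gen]]]]]].
pose arg k := tsubst (fun j => Var S (pickle (k, j))) (t k).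
pose decode (w : 'I_(ar i) -> nat -> A) n :=
  if unpickle n is Some (k, j) then w k j else op p0.
have eval_decode w : eval (decode w) (App arg) = op (fun k => eval (w k) (t k)).
  rewrite /=; congr op; apply/funext => k; rewrite eval_tsubst; congr eval.
  by apply/funext => j; rewrite /= /decode pickleK.
exists (App arg),
  (fun n => if unpickle n is Some (k, j) then c k j else true),
  (decode P), (decode Q), (decode R), (decode T).
split=> [n|]; last first.
  by rewrite !eval_decode; split; congr op; apply/funext => k; have [_ []] := gen k.
rewrite /decode; case: unpickle => [[k j]|]; first by have [] := gen k.
by split=> //; exact: con_refl.
Qed.

(* Column generators are moved to the variables below a bound N of the support of the
   term, and row generators to the variables above it. *)
Lemma centralizesP a b d : centralizes a b d <-> central a b d.
Proof.
split=> [C p q r s|dM t m e e' f f' ee' ff']; last by apply: dM; exact: matrix_eval.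
case/matrix_eval_generators=> t [c [P [Q [R [T [gen [-> -> -> ->]]]]]]].
have [N suppN] := eval_finite_support t.
pose sep n := Var S (if c n then n else N + n).
pose e n := P n; pose e' n := if c n then R n else P n.
pose f n := P (n - N); pose f' n := if c (n - N) then P (n - N) else Q (n - N).
have evalE (v w w' : nat -> A) :
    (forall n, n < N -> v n = if c n then w n else w' (N + n)) ->
    eval v t = eval (mixv N w w') (tsubst sep t).
  move=> vE; rewrite eval_tsubst; apply: suppN => n nN; rewrite vE // /sep /mixv.
  by case: (c n) => /=; rewrite ?nN // ltnNge leq_addr.
rewrite (evalE P e f) => [|n _]; last by rewrite /f addKn; case: ifP.
rewrite (evalE Q e f') => [|n _]; last first.
  by rewrite /f' addKn; have := gen n; case: (c n) => // -[<-].
rewrite (evalE R e' f) => [|n _]; last first.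
  by rewrite /e' /f addKn; have := gen n; case: (c n) => // -[<-].
rewrite (evalE T e' f') => [|n _]; last first.
  by rewrite /e' /f' addKn; have := gen n; case: (c n) => -[_ <-].
apply: C => n.
  by rewrite /e /e'; have := gen n; case: (c n) => [[]//|_]; exact: con_refl.
rewrite /f /f'; have := gen (n - N); case: (c _) => [_|[]//]; exact: con_refl.
Qed.

End Matrices.

Section PairAlgebra.
Local Open Scope order_scope.
Variables (S : signature) (A : algebra S) (b : congruence A).

Definition pair_car := {p : A * A | b p.1 p.2}.

Definition mkpair x y (xy : b x y) : pair_car :=
  exist (fun p : A * A => b p.1 p.2) (x, y) xy.

Definition pair_alg : algebra S :=
  @Algebra S pair_car (fun i f => mkpair (con_op (fun k => svalP (f k)))).

Implicit Types (X Y : pair_alg) (a d e : congruence A) (T : congruence pair_alg).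

Definition pfst X := (sval X).1.
Definition psnd X := (sval X).2.
Definition related d X : Prop := d (pfst X) (psnd X).
Definition diag x : pair_alg := mkpair (con_refl b x).

Lemma pair_ext X Y : pfst X = pfst Y -> psnd X = psnd Y -> X = Y.
Proof.
case: X Y => [[x y] xy] [[x' y'] xy']; rewrite /pfst /psnd /= => xx' yy'; subst x' y'.
by rewrite (Prop_irrelevance xy xy').
Qed.

Lemma pfst_morphism : morphism pfst. Proof. by []. Qed.

Lemma psnd_morphism : morphism psnd. Proof. by []. Qed.

Lemma diag_morphism : morphism diag.
Proof. by move=> i f; apply: pair_ext. Qed.

Lemma models_pair (E : term S -> term S -> Prop) : models E A -> models E pair_alg.
Proof.
move=> mA s t st v; apply: pair_ext.
  by rewrite -!(eval_morphism pfst_morphism); exact: mA.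
by rewrite -!(eval_morphism psnd_morphism); exact: mA.
Qed.

Definition delta a : congruence pair_alg :=
  con_gen (fun X Y => exists x y, [/\ a x y, X = diag x & Y = diag y]).

Lemma delta_leP a T : delta a <= T <-> a <= con_preim diag_morphism T.
Proof.
split=> [/con_gen_leP aT|/con_leP aT].
  by apply/con_leP => x y xy; apply: aT; exists x, y.
by apply/con_gen_leP => _ _ [x [y [/aT xy -> ->]]].
Qed.

Lemma delta_diag a x y : a x y -> delta a (diag x) (diag y).
Proof. by move=> xy; apply: con_gen_ub; exists x, y. Qed.

Lemma delta_join_le a a' : delta (a `|` a') <= delta a `|` delta a'.
Proof.
by apply/delta_leP; rewrite leUx; apply/andP; split; apply/delta_leP; rewrite ?leUl ?leUr.
Qed.

Definition matrix_rel a : prel pair_alg :=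
  fun X Y => matrix a b (pfst X) (psnd X) (pfst Y) (psnd Y).

Lemma matrix_delta a : psubrel (matrix_rel a) (delta a).
Proof.
suff main p q r s : matrix a b p q r s -> forall (pq : b p q) (rs : b r s),
    delta a (mkpair pq) (mkpair rs).
  by move=> [[p q] pq] [[r s] rs] /main; apply.
elim=> {p q r s} [x y xy|u v uv|i p q r s M IH] pq rs.
- have -> : mkpair pq = diag x by exact: pair_ext.
  have -> : mkpair rs = diag y by exact: pair_ext.
  exact: delta_diag.
- by rewrite (Prop_irrelevance pq rs); exact: con_refl.
have row k := matrix_row (M k).
have -> : mkpair pq = op (a := pair_alg) (fun k => mkpair (proj1 (row k))).
  exact: pair_ext.
have -> : mkpair rs = op (a := pair_alg) (fun k => mkpair (proj2 (row k))).
  exact: pair_ext.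
by apply: con_op => k; exact: IH.
Qed.

Lemma delta_tclos a : psubrel (delta a) (tclos (matrix_rel a)).
Proof.
have cM : is_con (tclos (matrix_rel a)).
  apply: is_con_tclos => [[[x y] xy]|X Y|i f g fg].
  - exact: MatrixRow.
  - exact: matrix_sym.
  - exact: MatrixOp.
move=> X Y; apply: (@le_con _ _ (delta a) (Congruence cM)).
apply/delta_leP/con_leP => x y xy; apply: tclos_sub; exact: MatrixCol.
Qed.

Lemma central_delta a d : central a b d <-> saturated (delta a) (related d).
Proof.
split=> [dM X Y /delta_tclos|dD p q r s M pq].
  by apply: (saturated_tclos (P := related d)) => {}X {}Y; exact: dM.
have [bpq brs] := matrix_row M.
by apply: (dD (mkpair bpq) (mkpair brs)) pq; exact: matrix_delta.
Qed.

Lemma central_join a a' d : central a b d -> central a' b d -> central (a `|` a') b d.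
Proof.
move=> /central_delta da /central_delta da'; apply/central_delta => X Y.
move/(le_con (delta_join_le a a')); exact: (saturated_join da da').
Qed.

Hypothesis modP : modular_con pair_alg.

Local Notation fst_ker := (con_preim pfst_morphism \bot).
Local Notation snd_ker := (con_preim psnd_morphism \bot).

Lemma meet_snd_fst_ker T : snd_ker `&` fst_ker <= T.
Proof. by apply/con_leP => X Y [e2 e1]; rewrite (pair_ext e1 e2); exact: con_refl. Qed.

Lemma delta_meet_fst_ker a d : central a b d ->
  delta a `&` fst_ker <= con_preim psnd_morphism d.
Proof.
move=> /central_delta dD; apply/con_leP => -[[x y] xy] [[x' y'] xy'] [DXY /= fXY].
rewrite /pfst /Delta /= in fXY; subst x'.
have yy' : b y y' := con_trans (con_sym xy) xy'.
have D_diag : delta a (diag y) (mkpair yy').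
  apply: (modular_shifting (a := snd_ker) (b := fst_ker) modP _ _ _ _ _ DXY) => //.
  exact: meet_snd_fst_ker.
exact: dD D_diag (con_refl d y).
Qed.

(* Shift along [delta a] from the diagonal rows to the given ones. *)
Lemma central_mono a d e : d <= e -> central a b d -> central a b e.
Proof.
move=> de abd p q r s M pq.
have [[bpq brs] [apr aqs]] := (matrix_row M, matrix_col M).
have D_rows : delta a (mkpair bpq) (mkpair brs) by exact: matrix_delta.
have ker_e : delta a `&` fst_ker <= con_preim psnd_morphism e.
  apply: le_trans (delta_meet_fst_ker abd) _.
  by apply/con_leP => X Y; exact: (le_con de).
exact: (modular_shifting (x := diag p) (z := diag r) modP ker_e
  (delta_diag apr) D_rows).
Qed.

Lemma central_sym a d : central a b d -> central b a d.
Proof.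
move=> abd p r q s /matrix_tr/matrix_swap M pr.
have [[bqp bsr] [aqs apr]] := (matrix_row M, matrix_col M).
have D_rows : delta a (mkpair bqp) (mkpair bsr) by exact: matrix_delta.
have ker_d : fst_ker `&` delta a <= con_preim psnd_morphism d.
  by rewrite meetC delta_meet_fst_ker.
exact: (modular_shifting (u := diag s) modP ker_d _ _ D_rows (delta_diag aqs)).
Qed.

End PairAlgebra.

Section Commutator.
Local Open Scope order_scope.
Variables (S : signature) (E : term S -> term S -> Prop).
Hypotheses (modE : congruence_modular E) (semE : semidegenerate E).
Variables (A : algebra S) (HA : models E A).
Implicit Types (a b c d : congruence A).

Definition commutator a b : congruence A := Congruence (is_con_bigmeet (centralizes a b)).

Lemma central_commutator a b : central a b (commutator a b).
Proof.
move=> p q r s M pq d cd C.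
exact: (proj1 (centralizesP a b (Congruence cd)) C _ _ _ _ M (pq d cd C)).
Qed.

Lemma modular_pair_alg b : modular_con (pair_alg b).
Proof. by apply: modE; exact: models_pair. Qed.

Lemma commutator_leP a b d : commutator a b <= d <-> central a b d.
Proof.
split=> [abd|abd].
  apply: (central_mono _ abd); [exact: modular_pair_alg|exact: central_commutator].
by apply/con_leP => x y; apply; [exact: con_relP|apply/centralizesP].
Qed.

Lemma commutatorC : commutative commutator.
Proof.
suff comm_le a b : commutator a b <= commutator b a.
  by move=> a b; apply/le_anti; rewrite !comm_le.
apply/commutator_leP; apply: central_sym; first exact: modular_pair_alg.
exact: central_commutator.
Qed.

Lemma commutator_lel a a' b : a <= a' -> commutator a b <= commutator a' b.
Proof.
move=> aa'; apply/con_leP => x y xy d cd C; apply: xy cd _ => t m e e' f f' ee'.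
by apply: C => n; exact: le_con (ee' n).
Qed.

Lemma commutatorUl : left_distributive commutator Order.join.
Proof.
move=> a b c; apply/le_anti; rewrite leUx; apply/andP; split.
  apply/commutator_leP.
  by apply: central_join; apply/commutator_leP; [exact: leUl|exact: leUr].
by rewrite !commutator_lel ?leUl ?leUr.
Qed.

(* The class of x is a one-element subalgebra of the quotient of B by d. *)
Lemma semidegenerate_con_top (B : algebra S) (d : congruence B) x :
  models E B -> (forall i : sym S, d (@op S B i (fun=> x)) x) -> d = \top.
Proof.
move=> mB dx; apply/eqP; rewrite -le1x; apply/con_leP => y z _; apply/cls_eq.
apply: contrapT => yz; apply: (semE (models_quot (th := d) mB)).
  by exists (cls d y), (cls d z).
exists (cls d x) => i f /funext ->; rewrite -(cls_morphism d).
exact/cls_eq.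
Qed.

Lemma commutator1x : left_id \top commutator.
Proof.
move=> a; apply/le_anti/andP; split.
  by apply/commutator_leP => p q r s /matrix_row[].
apply/con_leP => x y axy.
have delta_top : delta a \top = \top.
  apply: (semidegenerate_con_top (x := diag a x)) => [|i]; first exact: models_pair.
  by rewrite -(diag_morphism a); exact: delta_diag.
have /central_delta := @central_commutator \top a.
move/(_ (diag a x) (mkpair axy)); rewrite delta_top; apply=> //.
exact: con_refl.
Qed.

Lemma compact_con_top : compact_element (@con_bigjoin S A) \top.
Proof.
have [[x _]|A0] := pselect (exists x : A, True); last first.
  have <- : \bot = \top :> congruence A.
    by apply/con_eqP => x; exfalso; apply: A0; exists x.
  exact: compact_element0.
have <- : \join_(i : sym S) principal (@op S A i (fun=> x)) x = \top :> congruence A.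
  apply: (semidegenerate_con_top (x := x)) => // i.
  by apply/principal_leP; exact: joins_sup.
elim/big_ind: _ => [|a b|i _]; first exact: compact_element0.
  exact: compact_element_join.
exact: compact_principal.
Qed.

Lemma con_lifts_tfae t : K_comm_closed A ->
  [<-> lifts t; splits commutator t;
    forall a b, a `|` b = \top -> commutator a b = t -> splitting t a b;
    locally_indecomposable (@con_bigjoin S A) t].
Proof.
move=> commK; apply: (lifts_tfae commutatorC commutatorUl commutator1x).
- exact: con_bigjoinP.
- exact: con_algebraic.
- exact: compact_con_top.
- by move=> a b /compactP ka /compactP kb; apply/compactP; exact: commK.
Qed.

End Commutator.

Section Translation.
Local Open Scope order_scope.
Variables (S : signature) (A : algebra S).
Implicit Types (t : congruence A) (Q : prel A -> Prop).

Lemma splittingP a b t : splitting t a b <->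
  exists al nal, is_compl al nal /\ psubrel al (join t a) /\ psubrel nal (join t b).
Proof.
split=> [[e [e' [ee' /con_leP ea /con_leP e'b]]]|[R [R' [RR' [Ra R'b]]]]].
  by exists e, e'; split=> //; apply/is_complP.
have [cR [cR' _]] := RR'; exists (Congruence cR), (Congruence cR').
by split; [apply/is_complP|apply/con_leP|apply/con_leP].
Qed.

Lemma all_splittingP t Q :
  (forall a b : congruence A, a `|` b = \top -> Q (comm a b) -> splitting t a b) <->
  (forall phi psi, is_con phi -> is_con psi ->
     releq (join phi psi) (@Nabla A) -> Q (comm phi psi) ->
     exists al nal, is_compl al nal /\
       psubrel al (join t phi) /\ psubrel nal (join t psi)).
Proof.
split=> [sp phi psi cphi cpsi N Qc|sp a b /con_eqP ab Qab].
  apply/(splittingP (Congruence cphi) (Congruence cpsi)).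
  by apply: sp => //; apply/con_eqP.
by apply/splittingP; apply: sp => //; exact: con_relP.
Qed.

Lemma at_most_two_boolean_quotP t : at_most_two_boolean (quot t) <->
  forall a b, complements t a b -> a = \top \/ b = \top.
Proof.
split=> [/at_most_two_booleanP two a b ab|two]; last first.
  apply/at_most_two_booleanP => c d /complements_pull/two[cd|cd]; [left|right];
    by apply: pull_inj; rewrite pull1.
have [abt _] := ab; have [ta tb] : t <= a /\ t <= b by rewrite -abt leIl leIr.
move: ab; rewrite -(pull_push ta) -(pull_push tb) => /complements_pull/two.
by case=> ->; rewrite pull1; [left|right].
Qed.

Lemma locally_indecomposableP t : locally_indecomposable (@con_bigjoin S A) t <->
  forall phi, maximal_con phi -> at_most_two_boolean (quot (join t (diamond phi))).
Proof.
split=> [loc phi mphi|loc m /maximal_conP mm].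
  have [cphi _] := mphi; rewrite (diamondE (Congruence cphi)).
  apply/(at_most_two_boolean_quotP (t `|` con_bigjoin _)).
  by apply: loc; apply/maximal_conP.
by apply/at_most_two_boolean_quotP; have := loc m mm; rewrite diamondE.
Qed.

End Translation.

Theorem theorem6p3 (S : signature) (E : term S -> term S -> Prop)
  (HV : standing E) (A : algebra S) (HA : models E A) (th : prel A) (Hth : is_con th) :
  (CBLP th <->
   (forall phi psi, is_con phi -> is_con psi ->
      releq (join phi psi) (@Nabla A) -> psubrel (comm phi psi) th ->
      exists al nal, is_compl al nal /\
        psubrel al (join th phi) /\ psubrel nal (join th psi)))
  /\
  (CBLP th <->
   (forall phi psi, is_con phi -> is_con psi ->
      releq (join phi psi) (@Nabla A) -> releq (comm phi psi) th ->
      exists al nal, is_compl al nal /\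
        psubrel al (join th phi) /\ psubrel nal (join th psi)))
  /\
  (CBLP th <->
   (forall phi, maximal_con phi ->
      at_most_two_boolean (quot (join th (diamond phi))))).
Proof.
have [modE [semE /(_ A HA)[commK _]]] := HV.
pose t := Congruence Hth; have equiv := con_lifts_tfae modE semE HA t commK.
rewrite -[th]/(con_rel t) CBLP_lifts.
rewrite -(all_splittingP t (fun R => psubrel R t)).
rewrite -(all_splittingP t (fun R => releq R t)).
rewrite -locally_indecomposableP; split; last split; last exact: (equiv 0 3).
  apply: (iff_trans (equiv 0 1)); split=> sp a b ab abt; apply: sp => //;
    exact/(con_leP (commutator a b) t).
apply: (iff_trans (equiv 0 2)); split=> sp a b ab abt; apply: sp => //;
  exact/(con_eqP (commutator a b) t).
Qed.
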